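(* Let $X_1,X_2,Y$ be real Banach spaces, let $X=X_1\oplus_1 X_2$ and let $T: X\to Y$ be a narrow operator on $X$. Then the restrictions $T_1: X_1\to Y$, $T_1x_1=T(x_1,0)$, and $T_2: X_2\to Y$, $T_2x_2=T(0,x_2)$, are narrow operators on $X_1$ and $X_2$, respectively.
   Context: All Banach spaces are real; $S(X)$ denotes the unit sphere of $X$. $X_1\oplus_1 X_2$ is the direct sum with norm $\|(x_1,x_2)\|=\|x_1\|+\|x_2\|$. A bounded linear operator $T$ from a Banach space $X$ to some Banach space $Y$ is called a narrow operator (on $X$) if for all $x,y\in S(X)$, every $x^*\in X^*$ and every $\varepsilon>0$ there is $z\in S(X)$ with $\|x+z\|\ge 2-\varepsilon$ and $\|T(y-z)\|+|x^*(y-z)|\le\varepsilon$. *)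

(* Defs.v *)
From HB Require Import structures.
From mathcomp Require Import all_boot all_order all_algebra.
From mathcomp Require Import all_classical all_reals all_analysis.

Set Implicit Arguments.
Unset Strict Implicit.
Unset Printing Implicit Defensive.

Import Order.TTheory GRing.Theory Num.Theory.
Import numFieldNormedType.Exports.

Local Open Scope classical_set_scope.
Local Open Scope ring_scope.

(* An alias of X1 * X2 is needed because the library already equips the
   product of two normed modules with the max norm. Only the vector-space
   structure is inherited from the product. *)
Definition l1sum (R : realType) (X1 X2 : normedModType R) : Type :=
  (X1 * X2)%type.

Section l1sum_normed.
Context (R : realType) (X1 X2 : normedModType R).

HB.instance Definition _ :=
  GRing.Lmodule.copy (l1sum X1 X2) (X1 * X2)%type.

Definition l1norm (x : l1sum X1 X2) : R := `|x.1| + `|x.2|.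

Let l1normD (x y : l1sum X1 X2) : l1norm (x + y) <= l1norm x + l1norm y.
Proof. by rewrite /l1norm addrACA lerD// ler_normD. Qed.

Let l1normZ (a : R) (x : l1sum X1 X2) : l1norm (a *: x) = `|a| * l1norm x.
Proof. by rewrite /l1norm !normrZ mulrDr. Qed.

Let l1norm0_eq0 (x : l1sum X1 X2) : l1norm x = 0 -> x = 0.
Proof.
case: x => x1 x2 /eqP; rewrite /l1norm paddr_eq0//= !normr_eq0.
by move=> /andP[/eqP -> /eqP ->].
Qed.

HB.instance Definition _ :=
  Lmodule_isNormed.Build R (l1sum X1 X2) l1normD l1normZ l1norm0_eq0.

Lemma l1sum_normE (x : l1sum X1 X2) : `|x| = `|x.1| + `|x.2|.
Proof. by []. Qed.

End l1sum_normed.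

Section l1sum_complete.
Context (R : realType) (X1 X2 : completeNormedModType R).

Let l1sum_complete (F : set_system (l1sum X1 X2)) :
  ProperFilter F -> cauchy F -> cvg F.
Proof.
move=> FF /cauchyP Fc.
have c1 : cvg ((fun x : l1sum X1 X2 => x.1 : X1) @ F).
  apply: cauchy_cvg; apply: cauchy_exP => e e0; have [x Fx] := Fc e e0.
  exists x.1.
  apply: (@filterS _ F _ (ball x e)) Fx => y /=; rewrite -!ball_normE /ball_/=.
  by apply: le_lt_trans; rewrite l1sum_normE lerDl.
have c2 : cvg ((fun x : l1sum X1 X2 => x.2 : X2) @ F).
  apply: cauchy_cvg; apply: cauchy_exP => e e0; have [x Fx] := Fc e e0.
  exists x.2.
  apply: (@filterS _ F _ (ball x e)) Fx => y /=; rewrite -!ball_normE /ball_/=.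
  by apply: le_lt_trans; rewrite l1sum_normE lerDr.
have /cvg_ex[l1 /cvgrPdist_lt h1] := c1.
have /cvg_ex[l2 /cvgrPdist_lt h2] := c2.
apply/cvg_ex; exists ((l1, l2) : l1sum X1 X2); apply/cvgrPdist_lt => e e0.
have e20 : 0 < e / 2 by rewrite divr_gt0.
near=> x; rewrite l1sum_normE/= (splitr e) ltrD//.
- by near: x; exact: h1.
- by near: x; exact: h2.
Unshelve. all: by end_near. Qed.

HB.instance Definition _ :=
  Uniform_isComplete.Build (l1sum X1 X2) l1sum_complete.

End l1sum_complete.

Definition bounded_linear (R : realType) (X Y : normedModType R)
  (T : X -> Y) : Prop := linear T /\ bounded_fun_norm T.

(* R^o is the real line as a normed space, so x' ranges over the dual of X. *)
Definition narrow (R : realType) (X Y : completeNormedModType R)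
    (T : X -> Y) : Prop :=
  bounded_linear T /\
  forall x y : X, `|x| = 1 -> `|y| = 1 ->
  forall x' : X -> R^o, bounded_linear x' ->
  forall e : R, 0 < e ->
  exists z : X, [/\ `|z| = 1, 2 - e <= `|x + z| &
    `|T (y - z)| + `|x' (y - z)| <= e].

(* Main.v *)
Require Import Defs.
From HB Require Import structures.
From mathcomp Require Import all_boot all_order all_algebra.
From mathcomp Require Import all_classical all_reals all_analysis.
From mathcomp Require Import ring lra.

Set Implicit Arguments.
Unset Strict Implicit.
Unset Printing Implicit Defensive.

Import Order.TTheory GRing.Theory Num.Theory.
Import numFieldNormedType.Exports.

Local Open Scope ring_scope.

(** Why restrictions inherit narrowness.  Let [x], [y] be unit vectors of [X1],
    let [f] be a functional on [X1], and write [h] for a norm-one functional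
    with [h y = 1].  Narrowness of [T] applied to [(x, 0)] and [(y, 0)] yields
    some [z = (z1, z2)], but [z2] could carry a large part of the norm.  If in
    addition [h z1] is almost [1], then [`|z1|] is almost [1], so
    [`|z1| + `|z2| = 1] makes [z2] small, and normalizing [z1] gives the vector
    that is wanted.  Hence two functionals, [f] and [h], have to be controlled
    at once, whereas the definition of narrowness offers only one.

    This is what [narrow_two_functionals] provides.  Control of [al * h + f]
    with [al] large forces [h z] to be almost [1], because [h] cannot exceed
    [1] on the unit ball, and for the same reason it forces [f z] to be almost
    at least [f y].  Control of [al * h - f] gives in the same way a [w] with
    [f w] almost at most [f y].  A convex combination of [z] and [w] then has
    almost the right value under [f], and its images under [T] and [h] stay
    close to those of [y].  To keep it almost diametral to [x], choose [w]
    relative to the direction of [x + z] instead of [x]: then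
    [`|x + z + w|] is almost [3], and subtracting the complementary convex
    combination, of norm at most [1], leaves almost [2].

    The functional [h] is the Hahn-Banach functional of [y].  It is obtained by
    the route through minimal sublinear functionals: these are linear, and
    Zorn's lemma puts one below any given sublinear functional. *)

(** * Norming functionals *)

Lemma linear_fun0 (R : realType) (V W : lmodType R) (g : V -> W) :
  linear g -> g 0 = 0.
Proof.
by move=> lg; have := lg (-1) 0 0; rewrite scaler0 addr0 scaleN1r addNr.
Qed.

Lemma linear_funB (R : realType) (V W : lmodType R) (g : V -> W) (u v : V) :
  linear g -> g (u - v) = g u - g v.
Proof. by move=> lg; have := lg (-1) v u; rewrite !scaleN1r ![- _ + _]addrC. Qed.

(** Homogeneity is only required as an inequality, for all scalars [s >= 0];
    applying it to [s] and to [s^-1] gives the equality for [s > 0]. *)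
Definition sublinear (R : realType) (V : lmodType R) (p : V -> R) : Prop :=
  (forall u v, p (u + v) <= p u + p v) /\
  (forall (s : R) v, 0 <= s -> p (s *: v) <= s * p v).

Lemma sublinear0 (R : realType) (V : lmodType R) (p : V -> R) :
  sublinear p -> p 0 = 0.
Proof.
move=> [pD pZ]; apply/le_anti/andP; split.
  by have := pZ 0 0 (lexx _); rewrite scale0r mul0r.
by have := pD 0 0; rewrite addr0 -{1}[p 0]addr0 lerD2l.
Qed.

Lemma sublinear_ge_oppr (R : realType) (V : lmodType R) (p : V -> R) (v : V) :
  sublinear p -> - p (- v) <= p v.
Proof.
move=> sp; have := sp.1 (- v) v.
by rewrite addNr (sublinear0 sp) -lerBlDl sub0r.
Qed.

Lemma sublinear_norm (R : realType) (V : normedModType R) :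
  sublinear (fun v : V => `|v|).
Proof.
split=> [u v|s v s0]; first exact: ler_normD.
by rewrite normrZ ger0_norm.
Qed.

(** An infimum of sublinear functionals is sublinear when the family is
    directed downwards.  The hypotheses only ask for a member [r] that beats
    the given ones at the vectors in question, so that they also cover the
    members of the family defining [tilt], which need not be sublinear one by
    one. *)
Lemma sublinear_inf (R : realType) (V : lmodType R) (F : set (V -> R)) :
  (F !=set0)%classic ->
  (forall v, has_lbound [set p v | p in F]%classic) ->
  (forall p q u v, F p -> F q -> exists2 r, F r & r (u + v) <= p u + q v) ->
  (forall p s v, F p -> 0 <= s -> exists2 r, F r & r (s *: v) <= s * p v) ->
  sublinear (fun v => inf [set p v | p in F]%classic).
Proof.
move=> [p0 Fp0] lbF FD FZ.
have infle p v : F p -> inf [set p v | p in F]%classic <= p v.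
  by move=> Fp; apply: ge_inf => //; exists p.
split=> [u v|s v].
  rewrite -lerBlDr; apply: lb_le_inf; first by exists (p0 u), p0.
  move=> _ [p Fp <-]; rewrite lerBlDr -lerBlDl.
  apply: lb_le_inf; first by exists (p0 v), p0.
  move=> _ [q Fq <-]; rewrite lerBlDl.
  have [r Fr] := FD p q u v Fp Fq.
  by apply: le_trans; exact: infle.
rewrite le_eqVlt => /orP[/eqP <-|s0].
  rewrite mul0r; have [r Fr] := FZ p0 0 v Fp0 (lexx _).
  by rewrite mul0r; apply: le_trans; exact: infle.
rewrite -ler_pdivrMl//; apply: lb_le_inf; first by exists (p0 v), p0.
move=> _ [p Fp <-]; rewrite ler_pdivrMl//.
have [r Fr] := FZ p s v Fp (ltW s0).
by apply: le_trans; exact: infle.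
Qed.

(** The largest sublinear functional [q <= p] with [q (- u) <= - p u], that is,
    one that is linear along the line of [u]. *)
Definition tilt (R : realType) (V : lmodType R) (p : V -> R) (u v : V) : R :=
  inf [set q v | q in
    [set (fun v => p (v + t *: u) - t * p u) | t in [set t | 0 <= t]]]%classic.

Lemma tilt_lbound (R : realType) (V : lmodType R) (p : V -> R) (u v : V) :
  sublinear p ->
  has_lbound [set q v | q in
    [set (fun v => p (v + t *: u) - t * p u) | t in [set t | 0 <= t]]]%classic.
Proof.
move=> sp; exists (- p (- v)) => _ [_ [t /= t0 <-] <-].
have tup : t * p u <= p (t *: u).
  move: t0; rewrite le_eqVlt => /orP[/eqP <-|t0].
    by rewrite mul0r scale0r (sublinear0 sp).
  have ti : 0 <= t^-1 by rewrite invr_ge0 ltW.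
  have := sp.2 _ (t *: u) ti.
  by rewrite scalerA mulVf ?gt_eqF// scale1r ler_pdivlMl.
have := sp.1 (v + t *: u) (- v); rewrite addrAC subrr add0r.
by move=> h; move: tup h; set a := p (t *: u); set b := p (- v); set c := p (v + _); lra.
Qed.

Lemma tilt_le (R : realType) (V : lmodType R) (p : V -> R) (u v : V) (t : R) :
  sublinear p -> 0 <= t -> tilt p u v <= p (v + t *: u) - t * p u.
Proof.
move=> sp t0; apply: ge_inf; first exact: tilt_lbound.
by exists (fun v => p (v + t *: u) - t * p u) => //; exists t.
Qed.

Lemma tilt_le_self (R : realType) (V : lmodType R) (p : V -> R) (u v : V) :
  sublinear p -> tilt p u v <= p v.
Proof.
by move=> sp; have := tilt_le u v sp (lexx 0); rewrite scale0r mul0r addr0 subr0.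
Qed.

Lemma sublinear_tilt (R : realType) (V : lmodType R) (p : V -> R) (u : V) :
  sublinear p -> sublinear (tilt p u).
Proof.
move=> sp; apply: sublinear_inf => [|v||].
- by eexists; exists 0 => //=.
- exact: tilt_lbound.
- move=> _ _ v w [s /= s0 <-] [t /= t0 <-].
  eexists; first by exists (s + t) => //=; rewrite addr_ge0.
  have := sp.1 (v + s *: u) (w + t *: u).
  by rewrite /= scalerDl addrACA mulrDl; lra.
- move=> _ s v [t /= t0 <-] s0.
  eexists; first by exists (s * t) => //=; rewrite mulr_ge0.
  have := sp.2 s (v + t *: u) s0.
  by rewrite /= scalerDr scalerA mulrBr mulrA; lra.
Qed.

(** If [p] is minimal then [p <= tilt p u], and evaluating the infimum at
    [t = 1] gives [p v <= p (v + u) - p u]: superadditivity. *)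
Lemma minimal_sublinear_linear (R : realType) (V : lmodType R) (p : V -> R) :
  sublinear p ->
  (forall q, sublinear q -> (forall v, q v <= p v) -> forall v, p v <= q v) ->
  linear (p : V -> R^o).
Proof.
move=> sp minp.
have pD u v : p (v + u) = p v + p u.
  apply/le_anti; rewrite sp.1/= -lerBrDr.
  apply: (le_trans (minp _ (sublinear_tilt u sp) _ v)).
    by move=> w; exact: tilt_le_self.
  by have := tilt_le u v sp ler01; rewrite scale1r mul1r.
have pN v : p (- v) = - p v.
  by apply/eqP; rewrite -addr_eq0 -pD addNr (sublinear0 sp).
have pZ0 (s : R) v : 0 <= s -> p (s *: v) = s * p v.
  move=> s0; apply/le_anti; rewrite sp.2//= -lerN2 -pN -mulrN -pN -scalerN.
  exact: sp.2.
move=> a u v; rewrite pD; congr (_ + _).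
have [a0|a0] := leP 0 a; first by rewrite pZ0.
rewrite -[a]opprK scaleNr pN pZ0 ?oppr_ge0 ?(ltW a0)//.
by rewrite -mulNr.
Qed.

(** The Hahn-Banach theorem in the form needed here.  The infimum of a chain is
    finite since any sublinear [p <= q] satisfies [p v >= - q (- v)]. *)
Lemma linear_below_sublinear (R : realType) (V : lmodType R) (q : V -> R) :
  sublinear q ->
  exists2 f : V -> R^o, linear f & forall v, f v <= q v.
Proof.
move=> sq.
pose P (p : V -> R) := sublinear p /\ forall v, p v <= q v.
pose S := {p : V -> R | P p}.
have q0 : S by exists q.
pose le (r s : S) := `[< forall v, sval s v <= sval r v >].
have [|r s t|A totA|[p [sp pq]] minp] := @ZL_preorder S q0 le.
- by move=> r; apply/asboolP.
- move=> /asboolP rs /asboolP st; apply/asboolP => v.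
  exact: le_trans (st v) (rs v).
- have [[a Aa]|] := pselect (A !=set0)%classic; last first.
    by move=> A0; exists q0 => s As; exfalso; apply: A0; exists s.
  pose F := [set sval r | r in A]%classic.
  have lbF v : has_lbound [set p v | p in F]%classic.
    exists (- q (- v)) => _ [_ [[r [sr rq]] _ <-] <-] /=.
    apply: le_trans (sublinear_ge_oppr v sr).
    by rewrite lerN2 rq.
  have sF : sublinear (fun v => inf [set p v | p in F]%classic).
    apply: sublinear_inf => //.
    + by exists (sval a), a.
    + move=> _ _ u v [r Ar <-] [s As <-].
      have [/asboolP rs|/asboolP sr] := totA r s Ar As.
      * exists (sval s); first by exists s.
        by apply: (le_trans ((svalP s).1.1 u v)); rewrite lerD2r.
      * exists (sval r); first by exists r.
        by apply: (le_trans ((svalP r).1.1 u v)); rewrite lerD2l.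
    + move=> _ s v [r Ar <-] s0; exists (sval r); first by exists r.
      exact: (svalP r).1.2.
  have infle r v : A r -> inf [set p v | p in F]%classic <= sval r v.
    by move=> Ar; apply: ge_inf => //; exists (sval r) => //; exists r.
  have Fq v : inf [set p v | p in F]%classic <= q v.
    by apply: le_trans (infle a v Aa) _; exact: (svalP a).2.
  pose m : S := exist P _ (conj sF Fq).
  exists m => s As; apply/asboolP => v /=.
  exact: infle.
exists p => //; apply: minimal_sublinear_linear => // r sr rp.
have rq v : r v <= q v by exact: le_trans (rp v) (pq v).
have pr : le (exist P p (conj sp pq)) (exist P r (conj sr rq)).
  exact/asboolP.
by have /asboolP := minp _ pr.
Qed.

(** A linear functional below [tilt] of the norm at [y] is at most [- `|y|] at
    [- y]. *)
Lemma norming_functional (R : realType) (V : normedModType R) (y : V) :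
  exists h : V -> R^o,
    [/\ linear h, forall v, `|h v| <= `|v| & h y = `|y|].
Proof.
have sn := sublinear_norm V.
have [h lh hle] := linear_below_sublinear (sublinear_tilt y sn).
have hn v : h v <= `|v| by apply: le_trans (hle v) (tilt_le_self _ _ sn).
have hN v : h (- v) = - h v.
  by rewrite -[- v]sub0r linear_funB// linear_fun0// sub0r.
exists h; split=> // [v|].
  by rewrite ler_norml hn andbT lerNl -hN -normrN hn.
apply/le_anti; rewrite hn/= -lerN2 -hN.
apply: le_trans (hle _) _.
have := tilt_le y (- y) sn ler01.
by rewrite scale1r addNr normr0 mul1r sub0r.
Qed.

(** * Controlling two functionals at once *)

Lemma bounded_linear_le (R : realType) (X Y : normedModType R) (T : X -> Y) :
  bounded_linear T -> exists2 M, 0 <= M & forall v, `|T v| <= M * `|v|.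
Proof.
move=> [lT /(_ 1)[M TM]].
have T0 := linear_fun0 lT.
have M0 : 0 <= M by apply: le_trans (TM 0 _); rewrite ?normr0.
exists M => // v; have [->|v0] := eqVneq v 0; first by rewrite T0 !normr0 mulr0.
have nv : 0 < `|v| by rewrite normr_gt0.
have := TM (`|v|^-1 *: v).
rewrite normrZ ger0_norm ?invr_ge0// mulVf ?gt_eqF// => /(_ (lexx _)).
have -> : T (`|v|^-1 *: v) = `|v|^-1 *: T v.
  by have := lT (`|v|^-1) v 0; rewrite T0 !addr0.
by rewrite normrZ ger0_norm ?invr_ge0// ler_pdivrMl// mulrC.
Qed.

Lemma le_bounded_linear (R : realType) (X Y : normedModType R) (T : X -> Y) M :
  linear T -> (forall v, `|T v| <= M * `|v|) -> bounded_linear T.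
Proof.
move=> lT TM; split=> // r; exists (`|M| * r) => v vr.
apply: le_trans (TM v) _; apply: (@le_trans _ _ (`|M| * `|v|)).
  by rewrite ler_wpM2r// ler_norm.
by rewrite ler_wpM2l.
Qed.

Lemma convex_combination_near (R : realType) (a b c d : R) :
  0 <= d -> c - d <= a -> b <= c + d ->
  exists2 t, 0 <= t <= 1 & `|c - (t * a + (1 - t) * b)| <= d.
Proof.
move=> d0 ca bc; have [ac|ac] := leP a (c + d).
  by exists 1; rewrite ?ler01 ?lexx// ler_norml; lra.
have [cb|cb] := leP (c - d) b.
  by exists 0; rewrite ?ler01 ?lexx// ler_norml; lra.
have ab : 0 < a - b by lra.
exists ((c - b) / (a - b)).
  by rewrite divr_ge0 ?ler_pdivrMr//=; lra.
rewrite [X in `|X|](_ : _ = 0) ?normr0//.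
by field; lra.
Qed.

(** Narrowness for the single functional [al * h + f], written so that the two
    contributions can be separated: for [al >= 0] the first summand is
    nonnegative, which makes [f y - f z] at most [d]. *)
Lemma narrow_pencil (R : realType) (X Y : completeNormedModType R)
    (T : X -> Y) (x y : X) (f h : X -> R^o) (d al : R) :
  narrow T -> `|x| = 1 -> `|y| = 1 -> bounded_linear f -> linear h ->
  (forall v, `|h v| <= `|v|) -> h y = 1 -> 0 < d ->
  exists z, [/\ `|z| = 1, 2 - d <= `|x + z|, `|T y - T z| <= d &
    `|al * (1 - h z) + (f y - f z)| <= d].
Proof.
move=> [[lT _] nT] x1 y1 bf lh hle hy d0.
have [M M0 fM] := bounded_linear_le bf.
pose g : X -> R^o := fun v => al * h v + f v.
have lg : linear g.
  move=> a u v; rewrite /g lh bf.1 /GRing.scale/=; ring.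
have bg : bounded_linear g.
  apply: (@le_bounded_linear _ _ _ _ (`|al| + M)) => // v.
  rewrite /g (le_trans (ler_normD _ _))// mulrDl lerD// normrM.
  by rewrite ler_wpM2l.
have [z [z1 xz Tz]] := nT x y x1 y1 g bg d d0.
exists z; split=> //.
- rewrite -linear_funB//.
  by apply: le_trans Tz; rewrite lerDl.
- have -> : al * (1 - h z) + (f y - f z) = g (y - z).
    rewrite (linear_funB _ _ lg) /g hy; ring.
  by apply: le_trans Tz; rewrite lerDr.
Qed.

(** The vector [z] approximates [y] under [T], under [f] and under the norming
    functional [h] of [y] simultaneously.  Being a convex combination of unit
    vectors, it only satisfies [`|z| <= 1]. *)
Lemma narrow_two_functionals (R : realType) (X Y : completeNormedModType R)
    (T : X -> Y) (x y : X) (f h : X -> R^o) (e : R) :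
  narrow T -> `|x| = 1 -> `|y| = 1 -> bounded_linear f -> linear h ->
  (forall v, `|h v| <= `|v|) -> h y = 1 -> 0 < e ->
  exists z, [/\ `|z| <= 1, 2 - e <= `|x + z|, `|T y - T z| <= e,
    `|f y - f z| <= e & 1 - e <= h z].
Proof.
move=> nT x1 y1 bf lh hle hy e0.
have [L L0 fL] := bounded_linear_le bf.
have lT := nT.1.1.
(* the denominator ensures both [3 * d <= e] and [d < 1] *)
pose d := e / (3 + e).
have d0 : 0 < d by rewrite divr_gt0//; lra.
have d1 : d < 1 by rewrite ltr_pdivrMr; lra.
have de : 3 * d <= e.
  rewrite mulrA ler_pdivrMr; [nra|lra].
(* [al * (1 - h z)] will be at most [2 * L + d], as [f y - f z] varies within
   [2 * L]; since [d < 1], this bounds [1 - h z] by [e] *)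
pose al := (2 * L + 1) / e.
have al0 : 0 < al by rewrite divr_gt0//; lra.
have alE : al * e = 2 * L + 1 by rewrite divfK ?gt_eqF.
have hgood z (g : X -> R) : `|z| = 1 -> `|g y - g z| <= 2 * L ->
    `|al * (1 - h z) + (g y - g z)| <= d -> 1 - e <= h z.
  move=> z1 gz /ler_normlP[_ hz]; move/ler_normlP: gz => [gz _].
  have : al * (1 - h z) <= al * e by rewrite alE; lra.
  by rewrite ler_pM2l//; lra.
have fbd z : `|z| = 1 -> `|f y - f z| <= 2 * L.
  move=> z1; rewrite (le_trans (ler_normB _ _))//.
  by have := fL y; have := fL z; rewrite y1 z1; lra.
have hz1 z : `|z| = 1 -> 0 <= al * (1 - h z).
  move=> z1; rewrite mulr_ge0 ?(ltW al0)// subr_ge0.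
  by rewrite -z1 (le_trans _ (hle z))// ler_norm.
have [z [z1 xz Tz fz]] := narrow_pencil al nT x1 y1 bf lh hle hy d0.
set r := `|x + z| in xz.
have r2 : r <= 2 by rewrite (le_trans (ler_normD _ _))// x1 z1.
have r0 : 0 < r by lra.
(* the second vector is sought relative to the direction of [x + z] *)
pose x' := r^-1 *: (x + z).
have x'1 : `|x'| = 1.
  by rewrite normrZ ger0_norm ?invr_ge0 ?(ltW r0)// mulVf// gt_eqF.
have bNf : bounded_linear (fun v => - f v : R^o).
  apply: (@le_bounded_linear _ _ _ _ L) => [a u v|v]; last by rewrite normrN.
  by rewrite bf.1 /GRing.scale/=; ring.
have [w [w1 xw Tw fw]] := narrow_pencil al nT x'1 y1 bNf lh hle hy d0.
have xzw : 3 - 3 * d <= `|x + z + w|.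
  have rE : r *: (x' + w) = (x + z + w) + (r - 1) *: w.
    rewrite scalerDr scalerA divff ?gt_eqF// scale1r scalerBl scale1r.
    by rewrite -[RHS]addrA subrKC.
  have : `|r *: (x' + w)| <= `|x + z + w| + `|(r - 1) *: w|.
    by rewrite rE ler_normD.
  rewrite !normrZ w1 mulr1 (ger0_norm (ltW r0)) ger0_norm; [nra|lra].
have fz' : f y - d <= f z.
  by move/ler_normlP: fz => [_]; have := hz1 z z1; lra.
have fw' : f w <= f y + d.
  by move/ler_normlP: fw => [_]; have := hz1 w w1; lra.
have hz : 1 - e <= h z by apply: (hgood z f) => //; exact: fbd.
have hw : 1 - e <= h w.
  apply: (hgood w (fun v => - f v)) => //.
  by rewrite -opprD normrN; exact: fbd.
have [t /andP[t0 t1] ft] := convex_combination_near (ltW d0) fz' fw'.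
have s0 : 0 <= 1 - t by lra.
have comb (Z : lmodType R) (g : X -> Z) : linear g ->
    g (t *: z + (1 - t) *: w) = t *: g z + (1 - t) *: g w.
  move=> lg; rewrite lg; have := lg (1 - t) w 0.
  by rewrite (linear_fun0 lg) !addr0 => ->.
exists (t *: z + (1 - t) *: w); split.
- rewrite (le_trans (ler_normD _ _))// !normrZ z1 w1 !ger0_norm//; lra.
(* the vector is [x + z + w] minus the complementary convex combination *)
- have -> : x + (t *: z + (1 - t) *: w) =
      (x + z + w) - ((1 - t) *: z + t *: w).
    apply/eqP; rewrite eq_sym subr_eq -[eqbRHS]addrA addrACA -!scalerDl.
    by rewrite subrKC subrK !scale1r addrA.
  have : `|(1 - t) *: z + t *: w| <= 1.
    rewrite (le_trans (ler_normD _ _))// !normrZ z1 w1 !ger0_norm//; lra.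
  have := lerB_dist (x + z + w) ((1 - t) *: z + t *: w).
  lra.
- rewrite comb//.
  have -> : T y - (t *: T z + (1 - t) *: T w) =
      t *: (T y - T z) + (1 - t) *: (T y - T w).
    by rewrite !scalerBr addrACA -scalerDl -opprD subrKC scale1r.
  rewrite (le_trans (ler_normD _ _))// !normrZ !ger0_norm//; nra.
- rewrite comb; last exact: bf.1.
  by rewrite (le_trans ft)//; lra.
- rewrite comb// /GRing.scale/=; nra.
Qed.

(** * Restriction to an L-summand *)

(** The pair [(i, p)] presents [X1] as an L-summand of [X], which treats both
    summands of an l1-sum alike.  The vector [w = p z] has norm at least
    [h w >= 1 - d], so the complementary component of [z] has norm at most [d],
    and so has the change from [w] to its normalization [u]. *)
Lemma narrow_Lsummand (R : realType) (X X1 Y : completeNormedModType R)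
    (i : X1 -> X) (p : X -> X1) (T : X -> Y) :
  linear i -> linear p -> cancel i p ->
  (forall v, `|v| = `|p v| + `|v - i (p v)|) ->
  narrow T -> narrow (T \o i).
Proof.
move=> li lp ip nE nT.
have ni u : `|i u| = `|u| by rewrite nE ip subrr normr0 addr0.
have np v : `|p v| <= `|v| by rewrite [leRHS]nE lerDl.
have lT := nT.1.1.
have [K K0 TK] := bounded_linear_le nT.1.
split.
  apply: (@le_bounded_linear _ _ _ _ K) => [a u v|v] /=; first by rewrite li lT.
  by rewrite -(ni v).
move=> x y x1 y1 f bf e e0.
have [L L0 fL] := bounded_linear_le bf.
have [h [lh hle hy]] := norming_functional y.
(* [3 * d] is lost in the norm of [x + u], and [(1 + 2 * K) * d] and
   [(1 + L) * d] in the images of [y - u]; the last summand makes [d < 1],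
   hence [w] nonzero *)
pose d := e / (3 + 2 * K + L + e).
have D0 : 0 < 3 + 2 * K + L + e by lra.
have d0 : 0 < d by rewrite divr_gt0.
have d1 : d < 1 by rewrite ltr_pdivrMr; lra.
have dE : d * (3 + 2 * K + L + e) = e by rewrite divfK ?gt_eqF.
have bfp : bounded_linear (fun v => f (p v)).
  apply: (@le_bounded_linear _ _ _ _ L) => [a u v|v]; first by rewrite lp bf.1.
  by rewrite (le_trans (fL _))// ler_wpM2l.
have lhp : linear (fun v => h (p v) : R^o) by move=> a u v; rewrite lp lh.
have hple v : `|h (p v)| <= `|v| by rewrite (le_trans (hle _)).
have [|||z [z1 xz Tz fz hz]] :=
    narrow_two_functionals (x := i x) (y := i y) nT _ _ bfp lhp hple _ d0.
- by rewrite ni.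
- by rewrite ni.
- by rewrite ip hy.
move: fz; rewrite ip => fz.
set w := p z in fz hz.
have w1 : `|w| <= 1 by rewrite (le_trans (np z)).
have wd : 1 - d <= `|w|.
  by rewrite (le_trans hz)// (le_trans _ (hle w))// ler_norm.
have zw : `|z - i w| <= d by move: z1; rewrite nE -/w; lra.
have w0 : 0 < `|w| by lra.
pose u := `|w|^-1 *: w.
have u1 : `|u| = 1.
  by rewrite normrZ ger0_norm ?invr_ge0 ?(ltW w0)// mulVf// gt_eqF.
have uw : `|u - w| <= d.
  have -> : u - w = (1 - `|w|) *: u.
    by rewrite scalerBl scale1r /u scalerA divff ?gt_eqF// scale1r.
  by rewrite normrZ u1 mulr1 ger0_norm; lra.
have ziu : `|z - i u| <= 2 * d.
  have := ler_distD (i w) z (i u).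
  by rewrite -linear_funB// ni [`|w - u|]distrC; lra.
exists u; split=> //.
- have : `|i x + z| <= `|i x + i u| + `|z - i u|.
    have -> : i x + z = (i x + i u) + (z - i u) by rewrite -[RHS]addrA subrKC.
    exact: ler_normD.
  have -> : i x + i u = i (x + u) by have := li 1 x u; rewrite !scale1r.
  rewrite ni; nra.
- have Tu : `|T (i (y - u))| <= d + K * (2 * d).
    rewrite linear_funB// linear_funB//.
    have := ler_distD (T z) (T (i y)) (T (i u)).
    have := TK (z - i u); rewrite linear_funB//.
    have := ler_wpM2l K0 ziu; lra.
  have fu : `|f (y - u)| <= d + L * d.
    have lf := bf.1; rewrite (linear_funB _ _ lf).
    have := ler_distD (f w : R^o) (f y) (f u).
    have := fL (w - u); rewrite (linear_funB _ _ lf) [`|w - u|]distrC.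
    have := ler_wpM2l L0 uw; lra.
  rewrite /=; nra.
Qed.

Theorem theorem4p4 (R : realType) (X1 X2 Y : completeNormedModType R)
    (T : l1sum X1 X2 -> Y) :
  narrow T ->
  narrow (fun x1 : X1 => T (x1, 0)) /\ narrow (fun x2 : X2 => T (0, x2)).
Proof.
move=> nT; split.
- apply: (@narrow_Lsummand R (l1sum X1 X2) X1 Y (fun x1 => (x1, 0)) fst T) => //.
  + move=> a u v; have e0 : (0 : X2) = a *: 0 + 0 by rewrite scaler0 addr0.
    exact: (congr1 (pair (a *: u + v)) e0).
  + by move=> v; rewrite !l1sum_normE /= subrr normr0 add0r subr0.
- apply: (@narrow_Lsummand R (l1sum X1 X2) X2 Y (fun x2 => (0, x2)) snd T) => //.
  + move=> a u v; have e0 : (0 : X1) = a *: 0 + 0 by rewrite scaler0 addr0.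
    exact: (congr1 (pair^~ (a *: u + v)) e0).
  + by move=> v; rewrite !l1sum_normE /= subrr normr0 addr0 subr0 addrC.
Qed.
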